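(* There are infinitely many pairs of $D$-cospectral graphs $(G,H)$ such that $G$ and $H$ have different diameters and different Wiener indices.
   Context: All graphs are finite, simple, undirected and loopless. For a connected graph $G$ with vertices $v_1,\dots,v_n$, the distance matrix is the $n\times n$ matrix $D=(d_{ij})$, where $d_{ij}$ is the length of a shortest path between $v_i$ and $v_j$. Two connected graphs are $D$-cospectral if their distance matrices have the same spectrum (eigenvalues with multiplicities). The diameter of $G$ is the largest distance between two vertices of $G$. The Wiener index is $W(G)=\frac12\sum_{i=1}^n\sum_{j=1}^n d_{ij}$. *)

(* Defs.v *)
From HB Require Import structures.
From mathcomp Require Import all_boot all_order all_algebra all_field.

Set Implicit Arguments.
Unset Strict Implicit.
Unset Printing Implicit Defensive.

Import Order.TTheory GRing.Theory Num.Theory.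

Local Open Scope ring_scope.

Record cgraph := CGraph {
  nverts : nat;
  adj : rel 'I_nverts;
  adj_sym : symmetric adj;
  adj_irr : irreflexive adj;
  nverts_gt0 : (0 < nverts)%N;
  adj_conn : forall x y : 'I_nverts, connect adj x y }.

Definition has_path (G : cgraph) (x y : 'I_(nverts G)) (k : nat) : bool :=
  [exists p : k.-tuple 'I_(nverts G),
    [&& path (@adj G) x p, last x p == y & uniq (x :: p)]].

Lemma ex_path (G : cgraph) (x y : 'I_(nverts G)) : exists k, has_path x y k.
Proof.
have /connectP[p pP yE] := adj_conn x y.
move: yE; case: (shortenP pP) => q qP qU _ yE.
by exists (size q); apply/existsP; exists (in_tuple q); rewrite /= qP -yE eqxx -cons_uniq qU.
Qed.

Definition dist (G : cgraph) (x y : 'I_(nverts G)) : nat := ex_minn (ex_path x y).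

(* Over algC the characteristic polynomial splits, so the spectrum is complete. *)
Definition dist_mx (G : cgraph) : 'M[algC]_(nverts G) :=
  \matrix_(i, j) (dist i j)%:R.

Definition mult_eigen (n : nat) (M : 'M[algC]_n) (a : algC) : nat :=
  mup a (char_poly M).

Definition D_cospectral (G H : cgraph) : Prop :=
  forall a : algC, mult_eigen (dist_mx G) a = mult_eigen (dist_mx H) a.

Definition diameter (G : cgraph) : nat :=
  (\max_(i < nverts G) \max_(j < nverts G) dist i j)%N.

Definition wiener (G : cgraph) : rat :=
  2^-1 * \sum_(i < nverts G) \sum_(j < nverts G) (dist i j)%:R.

Definition isomorphic (G H : cgraph) : Prop :=
  exists f : 'I_(nverts G) -> 'I_(nverts H),
    bijective f /\ forall x y, adj (f x) (f y) = adj x y.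

Definition pair_isomorphic (P Q : cgraph * cgraph) : Prop :=
  isomorphic P.1 Q.1 /\ isomorphic P.2 Q.2.

(* Main.v *)
Require Import Defs.
From HB Require Import structures.
From mathcomp Require Import all_boot all_order all_algebra all_field.
From mathcomp Require Import zify.

Set Implicit Arguments.
Unset Strict Implicit.
Unset Printing Implicit Defensive.

Import Order.TTheory GRing.Theory Num.Theory.

(** Each pair consists of two blow-ups: the vertices of a base graph on six
    vertices are replaced by independent sets (classes of false twins).  Two
    vertices of one class are at distance 2, and vertices of distinct classes
    are as far apart as their classes.  Hence, if [b] is the distance matrix of
    the base graph with its diagonal changed from 0 to 2, and [C] is the
    vertex-class incidence matrix, the distance matrix of the blow-up is
    [C b C^T - 2].  By the identity between the characteristic polynomials of
    [C (b C^T)] and [(b C^T) C], its spectrum depends only on the number of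
    vertices and on the 6 by 6 quotient [b (C^T C)], where [C^T C] is the
    diagonal matrix of class sizes ([char_poly_blowup]).

    The two base graphs are
    - K4 minus an edge, with a pendant vertex attached to each end of the missing
      edge; its class sizes are proportional to 1, 1 (the pendant vertices),
      2, 4 (the vertices of degree 3 in the diamond), 2, 2;
    - the triangular prism minus an edge joining its two triangles, with all
      class sizes equal.
    Both quotients have eigenvalues 0, 4, 2, -4 with explicit integral
    eigenvectors, together with an invariant plane on which, in suitable bases,
    they act by the same matrix [[10, 12], [6, 12]].  So they are similar
    ([quotientG_basis], [quotientH_basis]) and the blow-ups are D-cospectral.
    Multiplying all class sizes by a common factor [m] multiplies both quotients
    by [m], which preserves similarity; this gives one pair on [12 m] vertices
    for every [m > 0].

    The diameters are those of the base graphs, 4 and 3.  Since both graphs have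
    the same number of vertices, the Wiener indices are compared through the
    sums of [b] over all pairs of vertices, which are [228 m^2] and
    [232 m^2]. *)

(** * Certifying distances *)

Section Descent.

Variables (T : finType) (e : rel T) (f : T -> T -> nat).
Hypothesis desc : forall x y, x != y -> exists2 z, e z y & f x y = (f x z).+1.

Lemma descent_path x y :
  exists p, [/\ path e x p, last x p = y & size p <= f x y].
Proof.
have [n] := ubnP (f x y); elim: n y => // n IH y lt_n.
have [<-|nxy] := eqVneq x y; first by exists [::].
have [z ezy fE] := desc nxy.
have [|p [pP pL pS]] := IH z; first by rewrite fE in lt_n.
exists (rcons p y); rewrite rcons_path last_rcons size_rcons pP pL ezy fE.
by split.
Qed.

Lemma descent_connect x y : connect e x y.
Proof. by have [p [pP pL _]] := descent_path x y; apply/connectP; exists p. Qed.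

End Descent.

Lemma lipschitz_path (T : finType) (e : rel T) (f : T -> nat) x p :
  (forall y z, e y z -> f z <= (f y).+1) -> path e x p ->
  f (last x p) <= f x + size p.
Proof.
move=> lip; elim: p x => [|y p IH] x /=; first by rewrite addn0.
by case/andP=> exy /IH; have := lip _ _ exy; lia.
Qed.

(** A 1-Lipschitz function bounds the distance from below; one that can be
    decreased by 1 along some edge as long as the endpoints differ bounds it from
    above. *)
Lemma dist_eq (G : cgraph) (f : 'I_(nverts G) -> 'I_(nverts G) -> nat) :
  (forall x, f x x = 0) ->
  (forall x y z, adj y z -> f x z <= (f x y).+1) ->
  (forall x y, x != y -> exists2 z, adj z y & f x y = (f x z).+1) ->
  forall x y, dist x y = f x y.
Proof.
move=> f0 lip desc x y; rewrite /dist.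
case: ex_minnP => k /existsP[p /and3P[pP /eqP pL _]] k_min.
have := lipschitz_path (lip x) pP; rewrite pL f0 size_tuple add0n => le_fk.
have [q [qP qL qS]] := descent_path desc x y.
move: qL; case: (shortenP qP) => r rP rU r_sub rL.
apply/eqP; rewrite eqn_leq le_fk andbT.
apply: leq_trans (leq_trans (uniq_leq_size _ r_sub) qS); last first.
  by case/andP: rU.
by apply: k_min; apply/existsP; exists (in_tuple r); rewrite rP rL eqxx.
Qed.

(** * Blow-ups *)

Section TwinTable.

Variables (k : nat) (b : 'I_k -> 'I_k -> nat).

(** The distance matrix of a connected graph on at least two vertices, with 2 on
    the diagonal; adjacency is the value 1.  The last two fields are the
    conditions on shortest walks: for [i = l] the last one says that [i] has a
    neighbour, through which any two twins of class [i] are at distance 2. *)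
Record twin_table : Prop := TwinTable {
  twin_diag : forall i, b i i = 2;
  twin_sym : forall i j, b i j = b j i;
  twin_lip : forall i j l, b j l = 1 -> b i l <= (b i j).+1;
  twin_desc : forall i l, b i l != 1 ->
    exists2 j, b j l = 1 & b i l = (b i j).+1 }.

End TwinTable.

Section Blowup.

Variables (k : nat) (b : 'I_k -> 'I_k -> nat) (bP : twin_table b).
Variables (n : nat) (c : 'I_n -> 'I_k) (c_surj : forall i, exists x, c x = i).
Hypothesis n_gt0 : 0 < n.

Definition blowup_adj : rel 'I_n := fun x y => b (c x) (c y) == 1.

Definition blowup_dist (x y : 'I_n) : nat :=
  if x == y then 0 else b (c x) (c y).

Lemma blowup_dist_lip x y z :
  blowup_adj y z -> blowup_dist x z <= (blowup_dist x y).+1.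
Proof.
rewrite /blowup_adj /blowup_dist => /eqP byz.
have [//|_] := eqVneq x z; have [->|_] := eqVneq x y; first by rewrite byz.
exact: (twin_lip bP).
Qed.

Lemma blowup_dist_desc x y : x != y ->
  exists2 z, blowup_adj z y & blowup_dist x y = (blowup_dist x z).+1.
Proof.
rewrite /blowup_adj /blowup_dist => /negPf nxy; rewrite nxy.
have [bxy|bxy] := eqVneq (b (c x) (c y)) 1.
  by exists x; rewrite ?bxy ?eqxx.
have [j bj bE] := twin_desc bP bxy; have [z cz] := c_surj j.
exists z; rewrite cz ?bj //; case: eqVneq => [xz|_]; last exact: bE.
by rewrite xz cz bj in bxy.
Qed.

Lemma blowup_adj_sym : symmetric blowup_adj.
Proof. by move=> x y; rewrite /blowup_adj (twin_sym bP). Qed.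

Lemma blowup_adj_irr : irreflexive blowup_adj.
Proof. by move=> x; rewrite /blowup_adj (twin_diag bP). Qed.

Definition blowup : cgraph :=
  CGraph blowup_adj_sym blowup_adj_irr n_gt0 (descent_connect blowup_dist_desc).

Lemma dist_blowup (x y : 'I_n) :
  dist (x : 'I_(nverts blowup)) y = blowup_dist x y.
Proof.
apply: (@dist_eq blowup) => [z|z u v|z u].
- by rewrite /blowup_dist eqxx.
- exact: blowup_dist_lip.
- exact: blowup_dist_desc.
Qed.

Lemma diameter_blowup_le d : (forall i j, b i j <= d) -> diameter blowup <= d.
Proof.
move=> le_bd; apply/bigmax_leqP=> x _; apply/bigmax_leqP=> y _.
by rewrite dist_blowup /blowup_dist; case: ifP.
Qed.

Lemma diameter_blowup_ge i j : i != j -> b i j <= diameter blowup.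
Proof.
have [[x <-] [y <-]] := (c_surj i, c_surj j) => nij.
have nxy : x != y by apply: contra_neq nij => ->.
apply: leq_trans (leq_bigmax (x : 'I_(nverts blowup))).
apply: leq_trans (leq_bigmax (y : 'I_(nverts blowup))).
by rewrite dist_blowup /blowup_dist (negPf nxy).
Qed.

Lemma blowup_distD (x y : 'I_n) :
  blowup_dist x y + (x == y) * 2 = b (c x) (c y).
Proof.
by rewrite /blowup_dist; case: eqVneq => [->|_]; rewrite ?addn0 ?(twin_diag bP).
Qed.

(** Adding 2 for every vertex turns the distances into values of the table, which
    depend on the classes alone. *)
Lemma wiener_blowup :
  (2 * wiener blowup + (2 * n)%:R
     = (\sum_(x < n) \sum_(y < n) b (c x) (c y))%N%:R)%R.
Proof.
rewrite /wiener mulrA divff // mul1r.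
transitivity ((\sum_(x < n) \sum_(y < n) blowup_dist x y)%N%:R
              + (\sum_(x < n) 2)%N%:R : rat)%R.
  congr (_ + _)%R; last by rewrite sum_nat_const card_ord mulnC.
  rewrite natr_sum; apply: eq_bigr => x _; rewrite natr_sum.
  by apply: eq_bigr => y _; rewrite dist_blowup.
rewrite -natrD -big_split /=; congr (_%:R)%R; apply: eq_bigr => x _.
under [RHS]eq_bigr => y _ do rewrite -blowup_distD.
rewrite big_split /=; congr addn; rewrite (bigD1 x) //= eqxx mul1n big1 ?addn0 //.
by move=> y; rewrite eq_sym => /negPf->.
Qed.

End Blowup.

(** * Spectra of blow-ups *)

Section Determinants.

Local Open Scope ring_scope.

(** Both sides are determinants of multiples of the block matrix with blocks
    [t], [A], [B], [1], by a block triangular matrix that clears [A] on one side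
    and [B] on the other. *)
Lemma det_sub_mulC (R : comNzRingType) n k (A : 'M[R]_(n, k)) (B : 'M[R]_(k, n))
    (t : R) :
  t ^+ k * \det (t%:M - A *m B) = t ^+ n * \det (t%:M - B *m A).
Proof.
pose M := block_mx t%:M A B 1%:M : 'M[R]_(n + k).
have detA : \det M = \det (t%:M - A *m B).
  have <- : \det (block_mx 1%:M (- A) 0 1%:M *m M) = \det M.
    by rewrite det_mulmx det_ublock !det1 !mul1r.
  rewrite mulmx_block !mul1mx !mul0mx !add0r mulmx1 mulNmx subrr.
  by rewrite det_lblock det1 mulr1.
have detB : t ^+ k * \det M = t ^+ n * \det (t%:M - B *m A).
  have <- : \det (block_mx 1%:M 0 (- B) t%:M *m M) = t ^+ k * \det M.
    by rewrite det_mulmx det_lblock det1 det_scalar mul1r.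
  rewrite mulmx_block !mul1mx !mul0mx !addr0 mulmx1 !mulNmx -scalar_mxC addNr.
  by rewrite det_ublock det_scalar addrC.
by rewrite -detA detB.
Qed.

Lemma det_sub_intertwined (R : idomainType) k (A N Q : 'M[R]_k) (t : R) :
  A *m Q = Q *m N -> \det Q != 0 -> \det (t%:M - A) = \det (t%:M - N).
Proof.
move=> AQ nzQ; apply: (mulIf nzQ); rewrite -det_mulmx mulmxBl AQ.
by rewrite -scalar_mxC -mulmxBr det_mulmx mulrC.
Qed.

Lemma char_poly_sub_scalar (R : comNzRingType) n (A : 'M[R]_n) (a : R) :
  char_poly (A - a%:M) = \det (('X + a%:P)%:M - map_mx polyC A).
Proof.
rewrite /char_poly /char_poly_mx; congr (\det _).
by rewrite map_mxB map_scalar_mx opprB addrA raddfD.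
Qed.

End Determinants.

Section BlowupSpectrum.

Local Open Scope ring_scope.

(** With [C] the incidence matrix of [c], this is [b (C^T C)], since
    [C^T C] is the diagonal matrix of class sizes. *)
Definition quotient_mx k n (b : 'I_k -> 'I_k -> nat) (c : 'I_n -> 'I_k) :
    'M[algC]_k :=
  \matrix_(i, j) (b i j * \sum_(x < n) (c x == j))%:R.

(** The factor on the left compensates for the missing division by a power of
    ['X + 2]: the [n - k] eigenvalues of the blow-up that do not come from the
    quotient are all equal to -2. *)
Lemma char_poly_blowup k (b : 'I_k -> 'I_k -> nat) (bP : twin_table b)
    n (c : 'I_n -> 'I_k) (c_surj : forall i, exists x, c x = i) (n_gt0 : (0 < n)%N) :
  ('X + 2%:P) ^+ k * char_poly (dist_mx (blowup bP c_surj n_gt0))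
  = ('X + 2%:P) ^+ n
      * \det (('X + 2%:P)%:M - map_mx polyC (quotient_mx b c)).
Proof.
pose C : 'M[algC]_(n, k) := \matrix_(x, i) (c x == i)%:R.
pose B : 'M[algC]_k := \matrix_(i, j) (b i j)%:R.
have CE p (A : 'M_(k, p)) : C *m A = \matrix_(x, j) A (c x) j.
  apply/matrixP=> x j; rewrite !mxE (bigD1 (c x)) //= !mxE eqxx mul1r big1 ?addr0 //.
  by move=> i; rewrite eq_sym mxE => /negPf->; rewrite mul0r.
have -> : dist_mx (blowup bP c_surj n_gt0) = C *m (B *m C^T) - 2%:M.
  rewrite CE; apply/matrixP=> x y; rewrite !mxE dist_blowup.
  rewrite (bigD1 (c y)) //= !mxE eqxx mulr1 big1 => [|j]; last first.
    by rewrite !mxE eq_sym => /negPf->; rewrite mulr0.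
  by rewrite addr0 -(blowup_distD bP) natrD natrM mulr_natl addrK.
have -> : quotient_mx b c = B *m C^T *m C.
  rewrite -mulmxA; apply/matrixP=> i j; rewrite !mxE (bigD1 j) //= !mxE.
  rewrite [X in _ + X]big1 => [|l nlj].
    rewrite addr0 natrM natr_sum; congr (_ * _); apply: eq_bigr => x _.
    by rewrite !mxE -natrM mulnb andbb.
  rewrite !mxE big1 ?mulr0 // => x _; rewrite !mxE -natrM mulnb.
  by case: eqP => // ->; rewrite (negPf nlj).
rewrite char_poly_sub_scalar (map_mxM _ C) (map_mxM _ (B *m C^T) C).
exact: det_sub_mulC.
Qed.

Lemma D_cospectral_blowup k n (n_gt0 : (0 < n)%N) (N Q1 Q2 : 'M[algC]_k)
    (b1 b2 : 'I_k -> 'I_k -> nat) (b1P : twin_table b1) (b2P : twin_table b2)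
    (c1 c2 : 'I_n -> 'I_k)
    (c1_surj : forall i, exists x, c1 x = i)
    (c2_surj : forall i, exists x, c2 x = i) :
  quotient_mx b1 c1 *m Q1 = Q1 *m N -> \det Q1 != 0 ->
  quotient_mx b2 c2 *m Q2 = Q2 *m N -> \det Q2 != 0 ->
  D_cospectral (blowup b1P c1_surj n_gt0) (blowup b2P c2_surj n_gt0).
Proof.
have detE (A Q : 'M[algC]_k) t : A *m Q = Q *m N -> \det Q != 0 ->
    \det (t%:M - map_mx polyC A) = \det (t%:M - map_mx polyC N).
  move=> AQ nzQ; apply: (@det_sub_intertwined _ _ _ _ (map_mx polyC Q)).
    by rewrite -!map_mxM AQ.
  by rewrite det_map_mx polyC_eq0.
move=> AQ1 nzQ1 AQ2 nzQ2 a; rewrite /mult_eigen; congr mup.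
have nzX2 : ('X + 2%:P : {poly algC}) != 0 by rewrite -size_poly_eq0 size_XaddC.
apply: (mulfI (expf_neq0 k nzX2)).
by rewrite !char_poly_blowup (detE _ _ _ AQ1) // (detE _ _ _ AQ2).
Qed.

End BlowupSpectrum.

(** * Periodic class words *)

Lemma sum_modn (F : nat -> nat) m p :
  \sum_(x < m * p) F (x %% p) = m * \sum_(r < p) F r.
Proof.
elim: m => [|m IH]; first by rewrite big_ord0.
rewrite !mulSn big_split_ord; congr (_ + _).
  by apply: eq_bigr => r _; rewrite /= modn_small ?ltn_ord.
by rewrite -IH; apply: eq_bigr => x _; rewrite /= modnDl.
Qed.

Section Words.

Variables (k : nat) (t : seq (seq nat)) (w : seq nat).

Definition entry (i j : nat) : nat := nth 0 (nth [::] t i) j.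

Definition table (i j : 'I_k.+1) : nat := entry i j.

Definition twin_check : bool :=
  let I := iota 0 k.+1 in
  all (fun i => (entry i i == 2) && all (fun l =>
    [&& entry i l == entry l i,
        all (fun j => (entry j l == 1) ==> (entry i l <= (entry i j).+1)) I &
        (entry i l != 1) ==>
          has (fun j => (entry j l == 1) && (entry i l == (entry i j).+1)) I]) I) I.

Lemma twin_checkP : twin_check -> twin_table table.
Proof.
have I_ord (i : 'I_k.+1) : (i : nat) \in iota 0 k.+1 by rewrite mem_iota ltn_ord.
move=> /allP chk; split=> [i|i l|i j l|i l] //.
- by case/andP: (chk _ (I_ord i)) => /eqP.
- by case/andP: (chk _ (I_ord i)) => _ /allP/(_ _ (I_ord l))/and3P[/eqP].
- have /andP[_ /allP/(_ _ (I_ord l))/and3P[_ /allP/(_ _ (I_ord j)) + _]] :=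
    chk _ (I_ord i).
  by rewrite /table => /implyP imp /eqP; apply: imp.
- have /andP[_ /allP/(_ _ (I_ord l))/and3P[_ _ /implyP imp]] := chk _ (I_ord i).
  move=> /imp/hasP[j jI /andP[/eqP bj /eqP bE]].
  rewrite mem_iota in jI; by exists (Ordinal jI).
Qed.

Variable m : nat.

(** The word [w] is read periodically, [m] times, so that every class is [m] times
    as large as its number of occurrences in [w]. *)
Definition word_class (x : 'I_(m * size w)) : 'I_k.+1 :=
  inord (nth 0 w (x %% size w)).

Hypothesis w_lt : all (fun a => a < k.+1) w.

Lemma sum_word_class (F : nat -> nat) :
  \sum_x F (word_class x) = m * \sum_(a <- w) F a.
Proof.
rewrite (big_nth 0) big_mkord -(sum_modn (fun r => F (nth 0 w r))).
apply: eq_bigr => x _; rewrite inordK //; apply: (allP w_lt); apply: mem_nth.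
by rewrite ltn_mod; case: (size w) x => // -[x]; rewrite muln0.
Qed.

Lemma word_class_surj :
  0 < m -> all (mem w) (iota 0 k.+1) -> forall i, exists x, word_class x = i.
Proof.
move=> m_gt0 /allP w_onto i; have wi : (i : nat) \in w.
  by apply: w_onto; rewrite mem_iota ltn_ord.
have lt_i : index (i : nat) w < m * size w.
  by apply: leq_trans (leq_pmull _ m_gt0); rewrite index_mem.
exists (Ordinal lt_i); rewrite /word_class /= modn_small ?index_mem //.
by rewrite nth_index // inord_val.
Qed.

Definition word_quotient : 'M[int]_k.+1 :=
  (\matrix_(i, j) (entry i j * count_mem (j : nat) w)%N%:Z)%R.

Lemma quotient_mx_word :
  quotient_mx table word_class = (m%:R *: map_mx intr word_quotient)%R.
Proof.
apply/matrixP=> i j; rewrite !mxE.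
rewrite (sum_word_class (fun a => a == j)) -[\sum_(_ <- _) _]big_mkcond /=.
by rewrite sum1_count -pmulrn -natrM mulnCA.
Qed.

End Words.

(** * The two tables *)

(** Classes 2, 3, 4, 5 form K4 minus the edge 45; 0 is pendant at 5 and 1 at 4. *)
Definition tabG : seq (seq nat) :=
  [:: [:: 2; 4; 2; 2; 3; 1];
      [:: 4; 2; 2; 2; 1; 3];
      [:: 2; 2; 2; 1; 1; 1];
      [:: 2; 2; 1; 2; 1; 1];
      [:: 3; 1; 1; 1; 2; 2];
      [:: 1; 3; 1; 1; 2; 2]].
Definition wordG : seq nat := [:: 0; 1; 2; 2; 3; 3; 3; 3; 4; 4; 5; 5].

(** Triangles 045 and 123 joined by the edges 25 and 34. *)
Definition tabH : seq (seq nat) :=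
  [:: [:: 2; 3; 2; 2; 1; 1];
      [:: 3; 2; 1; 1; 2; 2];
      [:: 2; 1; 2; 1; 2; 1];
      [:: 2; 1; 1; 2; 1; 2];
      [:: 1; 2; 2; 1; 2; 1];
      [:: 1; 2; 1; 2; 1; 2]].
Definition wordH : seq nat := [:: 0; 0; 1; 1; 2; 2; 3; 3; 4; 4; 5; 5].

Section Certificates.

Local Open Scope ring_scope.

Definition imx (s : seq (seq int)) : 'M[int]_6 :=
  \matrix_(i, j) nth 0 (nth [::] s i) j.

(** A plane with irrational eigenvalues [11 +- sqrt 73], where no integral
    eigenvectors exist, and the rational eigenvalues 0, 4, 2, -4. *)
Definition normal_form : 'M[int]_6 :=
  imx [:: [:: 10; 12; 0; 0; 0;  0];
          [::  6; 12; 0; 0; 0;  0];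
          [::  0;  0; 0; 0; 0;  0];
          [::  0;  0; 0; 4; 0;  0];
          [::  0;  0; 0; 0; 2;  0];
          [::  0;  0; 0; 0; 0; -4]].

(** The columns were found from the symmetry exchanging 0 with 1 and 4 with 5:
    the first four are invariant under it and the last two change sign.  The
    first two span an invariant plane, the others are eigenvectors. *)
Definition basisG : 'M[int]_6 :=
  imx [:: [:: 1; 2; -4;  0;  1;  2];
          [:: 1; 2; -4;  0; -1; -2];
          [:: 0; 2;  2;  0;  0;  0];
          [:: 1; 1;  1;  1;  0;  0];
          [:: 1; 1;  1; -1;  1; -1];
          [:: 1; 1;  1; -1; -1;  1]].

(** Weighted by the class sizes, the quotient is symmetric, so its eigenspaces are
    orthogonal for that weight: rows 3 to 6 are the corresponding columns of
    [basisG] times the class sizes.  The first two rows come from the basis of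
    the invariant plane dual to its given one.  All are scaled to small
    integers. *)
Definition cobasisG : 'M[int]_6 :=
  imx [:: [::  0;  0; -2;  2;  1;  1];
          [::  2;  2; 10; -2; -1; -1];
          [:: -2; -2;  2;  2;  1;  1];
          [::  0;  0;  0;  2; -1; -1];
          [::  1; -1;  0;  0;  2; -2];
          [::  1; -1;  0;  0; -1;  1]].

(** The symmetry group generated by (0 1)(2 5)(3 4) and (2 3)(4 5) splits the
    space by signs; the first two columns, the indicators of its two orbits, span
    the invariant plane. *)
Definition basisH : 'M[int]_6 :=
  imx [:: [:: 1; 0;  0;  0;  1;  2];
          [:: 1; 0;  0;  0; -1; -2];
          [:: 0; 1;  1;  1;  1; -1];
          [:: 0; 1; -1; -1;  1; -1];
          [:: 0; 1; -1;  1; -1;  1];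
          [:: 0; 1;  1; -1; -1;  1]].

Ltac imx_compute :=
  let i := fresh "i" in let lti := fresh "lti" in
  let j := fresh "j" in let ltj := fresh "ltj" in
  apply/matrixP=> -[i lti] [j ltj]; rewrite !mxE !big_ord_recl !big_ord0 !mxE /=;
  by do 6?[case: i lti => [|i] lti //]; do 6?[case: j ltj => [|j] ltj //].

Lemma quotientG_basis :
  word_quotient 5 tabG wordG *m basisG = basisG *m normal_form.
Proof. imx_compute. Qed.

Lemma quotientH_basis :
  word_quotient 5 tabH wordH *m basisH = basisH *m normal_form.
Proof. imx_compute. Qed.

Definition drow (s : seq int) : 'rV[int]_6 := \row_j s`_j.

Lemma basisG_cobasis :
  cobasisG *m basisG = diag_mx (drow [:: 4; 24; 24; 4; 6; 6]).
Proof. imx_compute. Qed.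

Lemma basisH_orthogonal :
  basisH^T *m basisH = diag_mx (drow [:: 2; 4; 4; 4; 6; 12]).
Proof. imx_compute. Qed.

Lemma det_basisG : \det basisG != 0.
Proof.
have: \det (cobasisG *m basisG) != 0.
  by rewrite basisG_cobasis det_diag !big_ord_recl big_ord0 !mxE.
by rewrite det_mulmx mulf_eq0 negb_or => /andP[].
Qed.

Lemma det_basisH : \det basisH != 0.
Proof.
have: \det (basisH^T *m basisH) != 0.
  by rewrite basisH_orthogonal det_diag !big_ord_recl big_ord0 !mxE.
by rewrite det_mulmx mulf_eq0 negb_or => /andP[].
Qed.

Lemma quotient_mx_intertwined t w m (Q N : 'M[int]_6) :
  all (fun a => a < 6)%N w -> word_quotient 5 t w *m Q = Q *m N ->
  quotient_mx (table t) (@word_class 5 w m) *m map_mx intr Q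
  = map_mx intr Q *m (m%:R *: map_mx intr N).
Proof.
move=> w_lt tQ.
by rewrite quotient_mx_word // -scalemxAl -scalemxAr -!map_mxM tQ.
Qed.

Lemma det_map_intr (Q : 'M[int]_6) :
  \det Q != 0 -> \det (map_mx intr Q : 'M[algC]_6) != 0.
Proof. by move=> nzQ; rewrite det_map_mx intr_eq0. Qed.

End Certificates.

(** * The family *)

Section Family.

Variable i : nat.
Let m := i.+1.

Lemma twin_tabG : twin_table (@table 5 tabG).
Proof. exact: twin_checkP. Qed.

Lemma twin_tabH : twin_table (@table 5 tabH).
Proof. exact: twin_checkP. Qed.

Lemma wordG_surj j : exists x, @word_class 5 wordG m x = j.
Proof. exact: word_class_surj. Qed.

Lemma wordH_surj j : exists x, @word_class 5 wordH m x = j.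
Proof. exact: word_class_surj. Qed.

Lemma vertices_gt0 : 0 < m * 12.
Proof. by []. Qed.

Definition graphG : cgraph := blowup twin_tabG wordG_surj vertices_gt0.
Definition graphH : cgraph := blowup twin_tabH wordH_surj vertices_gt0.

Lemma graphs_D_cospectral : D_cospectral graphG graphH.
Proof.
apply: D_cospectral_blowup.
- exact: quotient_mx_intertwined quotientG_basis.
- exact: det_map_intr det_basisG.
- exact: quotient_mx_intertwined quotientH_basis.
- exact: det_map_intr det_basisH.
Qed.

Lemma graphs_diameter : diameter graphH < diameter graphG.
Proof.
apply: (@leq_ltn_trans 3).
  apply: diameter_blowup_le => -[x ltx] [y lty]; rewrite /table /entry /=.
  by do 6?[case: x ltx => [|x] ltx //]; do 6?[case: y lty => [|y] lty //].
(* The two pendant classes. *)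
have far : (ord0 : 'I_6) != Ordinal (isT : 1 < 6) by [].
exact: (diameter_blowup_ge twin_tabG wordG_surj vertices_gt0 far).
Qed.

Lemma sum_table_word t w : all (fun a => a < 6) w ->
  \sum_x \sum_y @table 5 t (@word_class 5 w m x) (@word_class 5 w m y)
  = m * (m * \sum_(a <- w) \sum_(b <- w) entry t a b).
Proof.
move=> w_lt; rewrite big_distrr /=.
rewrite -(sum_word_class m w_lt (fun a => m * \sum_(b <- w) entry t a b)).
by apply: eq_bigr => x _; rewrite -(sum_word_class m w_lt).
Qed.

Lemma graphs_wiener : wiener graphG <> wiener graphH.
Proof.
move=> eqW; have := wiener_blowup twin_tabG wordG_surj vertices_gt0.
rewrite -[blowup _ _ _]/graphG eqW (wiener_blowup twin_tabH wordH_surj).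
rewrite !sum_table_word // => /eqP; rewrite eqr_nat !eqn_pmul2l //.
by rewrite !big_cons !big_nil.
Qed.

End Family.

Theorem theorem2 :
  exists P : nat -> cgraph * cgraph,
    (forall i j : nat, i <> j -> ~ pair_isomorphic (P i) (P j)) /\
    (forall i : nat,
       D_cospectral (P i).1 (P i).2 /\
       diameter (P i).1 <> diameter (P i).2 /\
       wiener (P i).1 <> wiener (P i).2).
Proof.
exists (fun i => (graphG i, graphH i)); split=> [i j nij [[f [f_bij _]] _]|i].
  have /= := bij_eq_card f_bij.
  by rewrite !card_ord => /eqP; rewrite eqn_pmul2r // eqSS => /eqP.
split; first exact: graphs_D_cospectral.
split; last exact: graphs_wiener.
by move=> /= eqd; have := graphs_diameter i; rewrite eqd ltnn.
Qed.
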